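(* (a) Let $\mathcal{X},\mathcal{Y},\mathfrak{Z}$ and $\mathcal{Z}_i,\tilde{\mathcal{Z}}_i$ ($i=1,\dots,\mathcal{M}$) be finite dimensional real Hilbert spaces, let $\Psi^{\langle i\rangle}\in\Gamma_0(\mathcal{Z}_i)$ be coercive with $\operatorname{dom}(\Psi^{\langle i\rangle})=\mathcal{Z}_i$, $\mu_i\in\mathbb{R}_{++}$, $B^{\langle i\rangle}\in\mathcal{B}(\mathcal{Z}_i,\tilde{\mathcal{Z}}_i)$ and $\mathfrak{L}_i\in\mathcal{B}(\mathcal{X},\mathcal{Z}_i)$. Let $\mathbf{C}\subset\mathfrak{Z}$ be nonempty closed convex and $\mathfrak{C}\in\mathcal{B}(\mathcal{X},\mathfrak{Z})$ with $\mathbf{C}\cap\operatorname{ran}\mathfrak{C}\neq\emptyset$. Define the product spaces $\mathcal{Z}:=\mathcal{Z}_1\times\cdots\times\mathcal{Z}_{\mathcal{M}}$, $\tilde{\mathcal{Z}}:=\tilde{\mathcal{Z}}_1\times\cdots\times\tilde{\mathcal{Z}}_{\mathcal{M}}$, the linear operators $B:\mathcal{Z}\to\tilde{\mathcal{Z}}:(z_1,\dots,z_{\mathcal{M}})\mapsto(\sqrt{\mu_1}B^{\langle1\rangle}z_1,\dots,\sqrt{\mu_{\mathcal{M}}}B^{\langle\mathcal{M}\rangle}z_{\mathcal{M}})$ and $\mathfrak{L}:\mathcal{X}\to\mathcal{Z}:x\mapsto(\mathfrak{L}_ix)_{1\le i\le\mathcal{M}}$, and the function $\Psi:=\bigoplus_{i=1}^{\mathcal{M}}\mu_i\Psi^{\langle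 i\rangle}$. Then $$\mathbf{\Psi}_{B_c}\circ\mathfrak{L}_c=\left(\sum_{i=1}^{\mathcal{M}}\mu_i\big(\Psi^{\langle i\rangle}\big)_{B^{\langle i\rangle}}\circ\mathfrak{L}_i\right)+(\iota_{\mathbf{C}}\circ\mathfrak{C}).$$ (b) In the situation of (a), let $\mathcal{X}=\mathbb{R}^n$, $\mathcal{Y}=\mathbb{R}^m$, $\mathcal{Z}_i=\mathbb{R}^{l_i}$ (Euclidean), $(A,\mathfrak{L}_i,\mu)\in\mathbb{R}^{m\times n}\times\mathbb{R}^{l_i\times n}\times\mathbb{R}_{++}$ with $\operatorname{rank}(\mathfrak{L}_i)=l_i$ ($i=1,\dots,\mathcal{M}$), and $y\in\mathbb{R}^m$. For each $i$ choose a nonsingular $\tilde{\mathfrak{L}}_i\in\mathbb{R}^{n\times n}$ satisfying $\begin{bmatrix}\mathrm{O}_{l_i\times(n-l_i)}&\mathrm{I}_{l_i}\end{bmatrix}\tilde{\mathfrak{L}}_i=\mathfrak{L}_i$, and $\omega_i\in\mathbb{R}_{++}$ with $\sum_{i=1}^{\mathcal{M}}\omega_i=1$. For each $i$ and $\theta_i\in[0,1]$ let $$B^{\langle i\rangle}_{\theta_i}:=\sqrt{\theta_i/\mu_i}\,\Lambda_i^{1/2}U_i^{\mathsf{T}}\in\mathbb{R}^{l_i\times l_i},$$ where $\begin{bmatrix}\tilde{A}_{1,i}&\tilde{A}_{2,i}\end{bmatrix}=\sqrt{\omega_i/\mu}\,A(\tilde{\mathfrak{L}}_i)^{-1}$ (with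 $\tilde A_{1,i}\in\mathbb{R}^{m\times(n-l_i)}$, $\tilde A_{2,i}\in\mathbb{R}^{m\times l_i}$) and $U_i\Lambda_iU_i^{\mathsf{T}}:=\tilde{A}_{2,i}^{\mathsf{T}}\tilde{A}_{2,i}-\tilde{A}_{2,i}^{\mathsf{T}}\tilde{A}_{1,i}(\tilde{A}_{1,i}^{\mathsf{T}}\tilde{A}_{1,i})^\dagger\tilde{A}_{1,i}^{\mathsf{T}}\tilde{A}_{2,i}$ is an eigendecomposition. Then $B^{\langle i\rangle}_{\theta_i}$ satisfies $$\Big(\sqrt{\tfrac{\omega_i}{\mu}}A\Big)^{\mathsf{T}}\Big(\sqrt{\tfrac{\omega_i}{\mu}}A\Big)-\mu_i\mathfrak{L}_i^{\mathsf{T}}\big(B^{\langle i\rangle}_{\theta_i}\big)^{\mathsf{T}}B^{\langle i\rangle}_{\theta_i}\mathfrak{L}_i\succeq\mathrm{O}_{n\times n}\quad(i=1,\dots,\mathcal{M}),$$ and, for $\theta=(\theta_1,\dots,\theta_{\mathcal{M}})$, the choice $B=B_\theta:\mathbb{R}^{l_1}\times\cdots\times\mathbb{R}^{l_{\mathcal{M}}}\to\mathbb{R}^{l_1}\times\cdots\times\mathbb{R}^{l_{\mathcal{M}}}:(z_1,\dots,z_{\mathcal{M}})\mapsto(\sqrt{\mu_1}B^{\langle1\rangle}_{\theta_1}z_1,\dots,\sqrt{\mu_{\mathcal{M}}}B^{\langle\mathcal{M}\rangle}_{\theta_{\mathcal{M}}}z_{\mathcal{M}})$ ensures $J_{\m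athbf{\Psi}_{B_c}\circ\mathfrak{L}_c}\in\Gamma_0(\mathbb{R}^n)$.
   Context: $\mathbb{R}_{++}$ is the set of positive reals; $\mathcal{B}(\mathcal{H},\mathcal{K})$ is the set of linear operators $\mathcal{H}\to\mathcal{K}$; $\mathrm{I}_l$ the identity matrix, $\mathrm{O}_{l\times k}$ the zero matrix; $^\dagger$ the Moore–Penrose pseudoinverse; $\succeq\mathrm{O}$ means positive semidefinite. In an eigendecomposition $U\Lambda U^{\mathsf T}$, $U$ is orthogonal and $\Lambda$ diagonal. Product spaces carry the sum inner product. $\Gamma_0(\mathcal{H})$ is the set of proper lower semicontinuous convex functions $\mathcal{H}\to(-\infty,\infty]$; $\operatorname{dom}\Psi:=\{z\mid\Psi(z)<\infty\}$; coercive means $\Psi(z)\to\infty$ as $\|z\|\to\infty$. $\iota_{\mathbf{C}}$ is the indicator function of $\mathbf{C}$ ($0$ on $\mathbf{C}$, $\infty$ elsewhere). $\big(\bigoplus_i\mu_i\Psi^{\langle i\rangle}\big)(z_1,\dots,z_{\mathcal{M}}):=\sum_i\mu_i\Psi^{\langle i\rangle}(z_i)$. Generalized Moreau enhanced (GME) penalty: for a function $F$ on a finite dimensional real Hilbert space $\mathcal{W}$ and a linear operator $M$ from $\mathcal{W}$ to a finite dimensional real Hilbert space $\tilde{\mathcal{W}}$, $$F_M(\cdot):=F(\cdot)-\min_{v\in\mathcal{W}}\Big[F(v)+\tfrac12\|M(\cdot-v)\|_{\tilde{\mathcal{W}}}^2\Big].$$ This defines $(\Psi^{\langle i\rangle})_{B^{\langle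 i\rangle}}$, and $\mathbf{\Psi}_{B_c}$ with the following data: $\mathcal{Z}_c:=\mathcal{Z}\times\mathfrak{Z}$, $\tilde{\mathcal{Z}}_c:=\tilde{\mathcal{Z}}\times\mathfrak{Z}$, $\mathbf{\Psi}:\mathcal{Z}_c\to(-\infty,\infty]:(z_1,z_2)\mapsto\Psi(z_1)+\iota_{\mathbf{C}}(z_2)$, $B_c:\mathcal{Z}_c\to\tilde{\mathcal{Z}}_c:(z_1,z_2)\mapsto(Bz_1,0_{\mathfrak{Z}})$. Also $\mathfrak{L}_c:\mathcal{X}\to\mathcal{Z}_c:x\mapsto(\mathfrak{L}x,\mathfrak{C}x)$ and $$J_{\mathbf{\Psi}_{B_c}\circ\mathfrak{L}_c}(x):=\tfrac12\|y-Ax\|_{\mathcal{Y}}^2+\mu\,\mathbf{\Psi}_{B_c}\circ\mathfrak{L}_c(x).$$ *)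

(* Defs.v *)
From HB Require Import structures.
From mathcomp Require Import all_boot all_order all_algebra.
From mathcomp Require Import all_classical all_reals all_analysis.
From mathcomp Require Import ring.

Set Implicit Arguments.
Unset Strict Implicit.
Unset Printing Implicit Defensive.

Import Order.TTheory GRing.Theory Num.Theory.
Import VectorInternalTheory.
Import numFieldNormedType.Exports.

Local Open Scope classical_set_scope.
Local Open Scope ring_scope.

(* The norm (hence the topology) is the one induced by the inner product;
   completeness is automatic in finite dimension. *)
HB.mixin Record NormedVector_hasInner (R : realType) (V : Type)
    & Vector R V & NormedModule R V := {
  inner : V -> V -> R ;
  innerC : forall x y, inner x y = inner y x ;
  innerDl : forall x y z, inner (x + y) z = inner x z + inner y z ;
  innerZl : forall (a : R) x y, inner (a *: x) y = a * inner x y ;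
  inner_normE : forall x, inner x x = `|x| ^+ 2
}.

#[short(type="hilbertType")]
HB.structure Definition Hilbert (R : realType) :=
  { V of NormedVector_hasInner R V & Vector R V & NormedModule R V }.

HB.factory Record Vector_hasInner (R : realType) (V : Type) & Vector R V := {
  inner : V -> V -> R ;
  innerC : forall x y, inner x y = inner y x ;
  innerDl : forall x y z, inner (x + y) z = inner x z + inner y z ;
  innerZl : forall (a : R) x y, inner (a *: x) y = a * inner x y ;
  inner_ge0 : forall x, 0 <= inner x x ;
  inner_eq0 : forall x, inner x x = 0 -> x = 0
}.

HB.builders Context R V & Vector_hasInner R V.

Let nrm (x : V) : R := Num.sqrt (inner x x).

Let innerDr x y z : inner z (x + y) = inner z x + inner z y.
Proof. by rewrite innerC innerDl !(innerC z). Qed.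

Let innerZr a x y : inner y (a *: x) = a * inner y x.
Proof. by rewrite innerC innerZl (innerC y). Qed.

Let sqr_nrm x : nrm x ^+ 2 = inner x x.
Proof. by rewrite sqr_sqrtr// inner_ge0. Qed.

Let cauchy_schwarz x y : inner x y <= nrm x * nrm y.
Proof.
have [y0|y0] := eqVneq (inner y y) 0.
  have -> : y = 0 by apply: inner_eq0.
  have z0 u : inner u 0 = 0 by rewrite -(scale0r 0) innerZr mul0r.
  by rewrite z0 /nrm z0 sqrtr0 mulr0.
have yp : 0 < inner y y by rewrite lt_def y0 inner_ge0.
have := inner_ge0 (inner y y *: x + (- inner x y) *: y).
rewrite !(innerDl, innerDr, innerZl, innerZr) (innerC y x).
set a := inner x x; set b := inner x y; set c := inner y y.
rewrite [X in 0 <= X](_ : _ = c * (a * c - b ^+ 2)); last by ring.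
rewrite pmulr_rge0// subr_ge0 => bac.
have [b0|/ltW b0] := leP 0 b; last first.
  by apply: (le_trans b0); rewrite mulr_ge0 ?sqrtr_ge0.
rewrite -(@ler_pXn2r _ 2)// ?nnegrE ?mulr_ge0 ?sqrtr_ge0//.
by rewrite exprMn !sqr_nrm.
Qed.

Let nrmD x y : nrm (x + y) <= nrm x + nrm y.
Proof.
rewrite -(@ler_pXn2r _ 2)// ?nnegrE ?addr_ge0 ?sqrtr_ge0//.
rewrite sqr_nrm sqrrD !sqr_nrm !(innerDl, innerDr) (innerC y x).
have h := cauchy_schwarz x y.
rewrite mulr2n !addrA lerD2r -!addrA lerD2l.
exact: lerD.
Qed.

Let nrmZ (l : R) x : nrm (l *: x) = `|l| * nrm x.
Proof.
by rewrite /nrm innerZl innerZr mulrA -expr2 sqrtrM ?sqr_ge0// sqrtr_sqr.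
Qed.

Let nrm_eq0 x : nrm x = 0 -> x = 0.
Proof. by move=> h; apply: inner_eq0; rewrite -sqr_nrm h expr0n. Qed.

HB.instance Definition _ := Lmodule_isNormed.Build R V nrmD nrmZ nrm_eq0.

Let inner_normE x : inner x x = `|x| ^+ 2.
Proof. by rewrite -sqr_nrm. Qed.

HB.instance Definition _ :=
  NormedVector_hasInner.Build R V innerC innerDl innerZl inner_normE.

HB.end.

(* Aliases are needed because the library already equips matrices and pairs
   with sup norms. *)
Definition euclid (R : realType) (n : nat) : Type := 'cV[R]_n.

Section Euclid.
Context (R : realType) (n : nat).
Notation E := (euclid R n).

HB.instance Definition _ := Vector.copy E 'cV[R]_n.

Definition euclid_inner (x y : E) : R := \sum_i x i 0 * y i 0.

Let eC x y : euclid_inner x y = euclid_inner y x.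
Proof. by apply: eq_bigr => i _; rewrite mulrC. Qed.
Let eD x y z :
  euclid_inner (x + y) z = euclid_inner x z + euclid_inner y z.
Proof. by rewrite -big_split; apply: eq_bigr => i _; rewrite mxE mulrDl. Qed.
Let eZ (a : R) x y : euclid_inner (a *: x) y = a * euclid_inner x y.
Proof. by rewrite mulr_sumr; apply: eq_bigr => i _; rewrite mxE mulrA. Qed.
Let e_ge0 x : 0 <= euclid_inner x x.
Proof. by apply: sumr_ge0 => i _; rewrite -expr2 sqr_ge0. Qed.
Let e_eq0 x : euclid_inner x x = 0 -> x = 0.
Proof.
move/eqP; rewrite psumr_eq0 => [/allP h|i _]; last by rewrite -expr2 sqr_ge0.
apply/matrixP => i j; rewrite ord1 mxE; apply/eqP.
by have := h i (mem_index_enum _); rewrite mulf_eq0 orbb.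
Qed.

HB.instance Definition _ := Vector_hasInner.Build R E eC eD eZ e_ge0 e_eq0.
End Euclid.

Definition hpair (R : realType) (V W : hilbertType R) : Type := (V * W)%type.

Section Pair.
Context (R : realType) (V W : hilbertType R).
Notation P := (hpair V W).

HB.instance Definition _ := Vector.copy P (V * W)%type.

Definition hpair_inner (x y : P) : R := inner x.1 y.1 + inner x.2 y.2.

Let pC x y : hpair_inner x y = hpair_inner y x.
Proof. by congr (_ + _); rewrite innerC. Qed.
Let pD x y z : hpair_inner (x + y) z = hpair_inner x z + hpair_inner y z.
Proof. by rewrite /hpair_inner !innerDl addrACA. Qed.
Let pZ (a : R) x y : hpair_inner (a *: x) y = a * hpair_inner x y.
Proof. by rewrite /hpair_inner !innerZl mulrDr. Qed.
Let p_ge0 x : 0 <= hpair_inner x x.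
Proof. by rewrite /hpair_inner !inner_normE addr_ge0 ?sqr_ge0. Qed.
Let p_eq0 x : hpair_inner x x = 0 -> x = 0.
Proof.
move/eqP; rewrite /hpair_inner !inner_normE paddr_eq0 ?sqr_ge0//.
by case: x => u v /=; rewrite !expf_eq0 /= !normr_eq0 => /andP[/eqP -> /eqP ->].
Qed.

HB.instance Definition _ := Vector_hasInner.Build R P pC pD pZ p_ge0 p_eq0.
End Pair.

Definition hprod (R : realType) (M : nat) (Z : 'I_M -> hilbertType R) : Type :=
  {dffun forall i, Z i}.

Section Prod.
Context (R : realType) (M : nat) (Z : 'I_M -> hilbertType R).
Notation P := (hprod Z).

HB.instance Definition _ := Choice.copy P {dffun forall i, Z i}.

Let zero : P := finfun (fun i => 0).
Let opp (x : P) : P := finfun (fun i => - x i).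
Let add (x y : P) : P := finfun (fun i => x i + y i).
Let scale (a : R) (x : P) : P := finfun (fun i => a *: x i).

Let addA : associative add.
Proof. by move=> x y z; apply/ffunP => i; rewrite !ffunE addrA. Qed.
Let addC : commutative add.
Proof. by move=> x y; apply/ffunP => i; rewrite !ffunE addrC. Qed.
Let add0 : left_id zero add.
Proof. by move=> x; apply/ffunP => i; rewrite !ffunE add0r. Qed.
Let addN : left_inverse zero opp add.
Proof. by move=> x; apply/ffunP => i; rewrite !ffunE addNr. Qed.

HB.instance Definition _ := GRing.isZmodule.Build P addA addC add0 addN.

Let scaleA a b v : scale a (scale b v) = scale (a * b) v.
Proof. by apply/ffunP => i; rewrite !ffunE scalerA. Qed.
Let scale1 : left_id 1 scale.
Proof. by move=> x; apply/ffunP => i; rewrite !ffunE scale1r. Qed.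
Let scaleDr : right_distributive scale +%R.
Proof. by move=> a x y; apply/ffunP => i; rewrite !ffunE scalerDr. Qed.
Let scaleDl v : {morph scale^~ v : a b / a + b}.
Proof. by move=> a b; apply/ffunP => i; rewrite !ffunE scalerDl. Qed.

HB.instance Definition _ :=
  GRing.Zmodule_isLmodule.Build R P scaleA scale1 scaleDr scaleDl.

Lemma hprodDE (x y : P) i : (x + y) i = x i + y i.
Proof. by rewrite ffunE. Qed.
Lemma hprodZE (a : R) (x : P) i : (a *: x) i = a *: x i.
Proof. by rewrite ffunE. Qed.
Lemma hprod0E i : (0 : P) i = 0.
Proof. by rewrite ffunE. Qed.

Let vect_axiom : Vector.axiom (\sum_i dim (Z i)) P.
Proof.
pose f (x : P) : 'rV[R]_(\sum_i dim (Z i)) := \mxrow_i v2r (x i).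
have fE x i : submxrow (f x) i = v2r (x i) by rewrite mxrowK.
exists f.
  move=> a x y; apply/mxrowP => i.
  have -> : submxrow (a *: f x + f y) i = a *: submxrow (f x) i + submxrow (f y) i.
    by apply/matrixP => k l; rewrite !mxE.
  rewrite !fE.
  by rewrite hprodDE hprodZE linearD linearZ.
exists (fun v => finfun (fun i => r2v (submxrow v i)) : P) => [x|v].
  by apply/ffunP => i; rewrite ffunE fE v2rK.
by apply/mxrowP => i; rewrite fE ffunE r2vK.
Qed.

HB.instance Definition _ := Lmodule_hasFinDim.Build R P vect_axiom.

Definition hprod_inner (x y : P) : R := \sum_i inner (x i) (y i).

Let pC x y : hprod_inner x y = hprod_inner y x.
Proof. by apply: eq_bigr => i _; rewrite innerC. Qed.
Let pD x y z : hprod_inner (x + y) z = hprod_inner x z + hprod_inner y z.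
Proof.
by rewrite -big_split; apply: eq_bigr => i _; rewrite hprodDE innerDl.
Qed.
Let pZ (a : R) x y : hprod_inner (a *: x) y = a * hprod_inner x y.
Proof.
by rewrite mulr_sumr; apply: eq_bigr => i _; rewrite hprodZE innerZl.
Qed.
Let p_ge0 x : 0 <= hprod_inner x x.
Proof. by apply: sumr_ge0 => i _; rewrite inner_normE sqr_ge0. Qed.
Let p_eq0 x : hprod_inner x x = 0 -> x = 0.
Proof.
move/eqP; rewrite psumr_eq0 => [/allP h|i _]; last first.
  by rewrite inner_normE sqr_ge0.
apply/ffunP => i; rewrite hprod0E; apply/eqP.
have := h i (mem_index_enum _).
by rewrite inner_normE expf_eq0 /= normr_eq0.
Qed.

HB.instance Definition _ := Vector_hasInner.Build R P pC pD pZ p_ge0 p_eq0.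
End Prod.

Definition mxop (R : realType) (m n : nat) (A : 'M[R]_(m, n))
  (x : euclid R n) : euclid R m := A *m x.

Definition hprod_stack (R : realType) (M : nat) (X : hilbertType R)
    (Z : 'I_M -> hilbertType R) (L : forall i, {linear X -> Z i}) (x : X) :
  hprod Z := finfun (fun i => L i x).

Definition weighted_op (R : realType) (M : nat) (Z Zt : 'I_M -> hilbertType R)
    (mu : 'I_M -> R) (B : forall i, {linear Z i -> Zt i}) (z : hprod Z) :
  hprod Zt := finfun (fun i => Num.sqrt (mu i) *: B i (z i)).

Definition pair_op (R : realType) (X V W : hilbertType R)
  (L : {linear X -> V}) (C : {linear X -> W}) (x : X) : hpair V W := (L x, C x).

Definition zero_ext (R : realType) (V Vt W : hilbertType R)
  (B : {linear V -> Vt}) (z : hpair V W) : hpair Vt W := (B z.1, 0).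

Section Linearity.
Context (R : realType).

Let mxop_linear m n (A : 'M[R]_(m, n)) : linear (mxop A).
Proof. by move=> a x y; rewrite /mxop; exact: linearP. Qed.
HB.instance Definition _ m n (A : 'M[R]_(m, n)) :=
  GRing.isLinear.Build R (euclid R n) (euclid R m) _ (mxop A) (mxop_linear A).

Let hprod_stack_linear M (X : hilbertType R) (Z : 'I_M -> hilbertType R)
  (L : forall i, {linear X -> Z i}) : linear (hprod_stack L).
Proof.
by move=> a x y; apply/ffunP => i; rewrite hprodDE hprodZE !ffunE linearP.
Qed.
HB.instance Definition _ M (X : hilbertType R) (Z : 'I_M -> hilbertType R)
    (L : forall i, {linear X -> Z i}) :=
  GRing.isLinear.Build R X (hprod Z) _ (hprod_stack L) (hprod_stack_linear L).

Let weighted_op_linear M (Z Zt : 'I_M -> hilbertType R) mu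
  (B : forall i, {linear Z i -> Zt i}) : linear (weighted_op mu B).
Proof.
move=> a x y; apply/ffunP => i.
rewrite hprodDE hprodZE !ffunE linearP scalerDr !scalerA.
by rewrite mulrC.
Qed.
HB.instance Definition _ M (Z Zt : 'I_M -> hilbertType R) mu
    (B : forall i, {linear Z i -> Zt i}) :=
  GRing.isLinear.Build R (hprod Z) (hprod Zt) _ (weighted_op mu B)
    (weighted_op_linear mu B).

Let pair_op_linear (X V W : hilbertType R) (L : {linear X -> V})
  (C : {linear X -> W}) : linear (pair_op L C).
Proof. by move=> a x y; rewrite /pair_op !linearP. Qed.
HB.instance Definition _ (X V W : hilbertType R) (L : {linear X -> V})
    (C : {linear X -> W}) :=
  GRing.isLinear.Build R X (hpair V W) _ (pair_op L C) (pair_op_linear L C).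

Let zero_ext_linear (V Vt W : hilbertType R) (B : {linear V -> Vt}) :
  linear (zero_ext (W := W) B).
Proof.
move=> a x y; apply: injective_projections => /=.
  by rewrite linearP.
by rewrite scaler0 addr0.
Qed.
HB.instance Definition _ (V Vt W : hilbertType R) (B : {linear V -> Vt}) :=
  GRing.isLinear.Build R (hpair V W) (hpair Vt W) _ (zero_ext (W := W) B)
    (zero_ext_linear (W := W) B).
End Linearity.

Section ConvexAnalysis.
Context (R : realType).
Local Open Scope ereal_scope.

Definition edom (H : Type) (f : H -> \bar R) : set H := [set z | f z < +oo].

Definition eproper (H : Type) (f : H -> \bar R) : Prop :=
  (forall z, -oo < f z) /\ edom f !=set0.

(* Only meant for functions that never take the value -oo. *)
Definition econvex (H : lmodType R) (f : H -> \bar R) : Prop :=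
  forall (x y : H) (t : R), (0 < t < 1)%R ->
    f (t *: x + (1 - t) *: y)%R <= t%:E * f x + (1 - t)%:E * f y.

Definition Gamma0 (H : hilbertType R) : set (H -> \bar R) :=
  [set f | [/\ eproper f, lower_semicontinuous f & econvex f]].

Definition coercive (H : hilbertType R) (f : H -> \bar R) : Prop :=
  forall a : R, exists r : R, forall z : H, (r < `|z|)%R -> a%:E < f z.

Definition eindicator (H : Type) (C : set H) (z : H) : \bar R :=
  if z \in C then 0 else +oo.

Definition is_emin (A : set (\bar R)) (m : \bar R) : Prop :=
  A m /\ lbound A m.

Definition has_emin (A : set (\bar R)) : Prop := exists m, is_emin A m.

(* [+oo] is a junk value for sets without a minimum. *)
Definition emin (A : set (\bar R)) : \bar R := xget +oo (is_emin A).

Definition gme_objective (W Wt : hilbertType R) (F : W -> \bar R)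
    (M : {linear W -> Wt}) (z v : W) : \bar R :=
  F v + (2^-1 * `|M (z - v)%R| ^+ 2)%:E.

Definition gme (W Wt : hilbertType R) (F : W -> \bar R) (M : {linear W -> Wt})
    (z : W) : \bar R :=
  F z - emin (range (gme_objective F M z)).

Definition weighted_sum (N : nat) (Z : 'I_N -> hilbertType R) (mu : 'I_N -> R)
    (Psi : forall i, Z i -> \bar R) (z : hprod Z) : \bar R :=
  \sum_i (mu i)%:E * Psi i (z i).

Definition add_constraint (V W : hilbertType R) (Psi : V -> \bar R)
    (C : set W) (z : hpair V W) : \bar R :=
  Psi z.1 + eindicator C z.2.

(* [G] stands for the whole composition of the penalty with the operator. *)
Definition J (X Y : hilbertType R) (y : Y) (A : {linear X -> Y}) (mu : R)
    (G : X -> \bar R) (x : X) : \bar R :=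
  (2^-1 * `|y - A x| ^+ 2)%:E + mu%:E * G x.

End ConvexAnalysis.
Arguments eindicator {R H} C z.

Section Matrices.
Context (R : realType).

Definition psdmx n (S : 'M[R]_n) : Prop :=
  S^T = S /\ forall v : 'cV[R]_n, 0 <= (v^T *m S *m v) 0 0.

Definition is_mpinv m n (A : 'M[R]_(m, n)) (P : 'M[R]_(n, m)) : Prop :=
  [/\ A *m P *m A = A, P *m A *m P = P,
      (A *m P)^T = A *m P & (P *m A)^T = P *m A].

(* The library's [pinvmx] is not the Moore-Penrose pseudoinverse. *)
Definition mpinv m n (A : 'M[R]_(m, n)) : 'M[R]_(n, m) :=
  xget 0 (is_mpinv A).

Lemma is_mpinv_uniq m n (A : 'M[R]_(m, n)) P Q :
  is_mpinv A P -> is_mpinv A Q -> P = Q.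
Proof.
move=> [P1 P2 P3 P4] [Q1 Q2 Q3 Q4].
have AP : A *m P = A *m Q.
  have -> : A *m P = (A *m Q) *m (A *m P) by rewrite mulmxA Q1.
  by rewrite -{1}Q3 -P3 -trmx_mul mulmxA P1 Q3.
have PA : P *m A = Q *m A.
  have -> : P *m A = (P *m A) *m (Q *m A) by rewrite -mulmxA (mulmxA A) Q1.
  by rewrite -{1}P4 -Q4 -trmx_mul -mulmxA (mulmxA A) P1 Q4.
by rewrite -P2 PA -mulmxA AP mulmxA Q2.
Qed.

Lemma gram_unit m n (F : 'M[R]_(m, n)) : row_free F -> F *m F^T \in unitmx.
Proof.
move=> Ffree; rewrite -row_free_unit -kermx_eq0 -submx0.
apply/rV_subP => v /sub_kermxP; rewrite mulmxA => vFF.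
suff vF : v *m F = 0.
  by rewrite submx0; apply/eqP/(row_free_inj Ffree); rewrite vF mul0mx.
have : (v *m F *m (v *m F)^T) 0 0 = 0 by rewrite trmx_mul mulmxA vFF mul0mx mxE.
rewrite mxE => /eqP; rewrite psumr_eq0 => [/allP h|j _]; last first.
  by rewrite [_^T _ _]mxE -expr2 sqr_ge0.
apply/matrixP => i j; rewrite ord1 [RHS]mxE; apply/eqP.
by have := h j (mem_index_enum _); rewrite [_^T _ _]mxE mulf_eq0 orbb.
Qed.

Lemma is_mpinv_factor m n r (C : 'M[R]_(m, r)) (F : 'M[R]_(r, n)) :
  row_free C^T -> row_free F ->
  is_mpinv (C *m F)
    (F^T *m invmx (F *m F^T) *m invmx (C^T *m C) *m C^T).
Proof.
move=> Cfree Ffree; set GF := F *m F^T; set GC := C^T *m C.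
have GFu : GF \in unitmx by exact: gram_unit.
have GCu : GC \in unitmx by have := gram_unit Cfree; rewrite trmxK.
have GFt : GF^T = GF by rewrite trmx_mul trmxK.
have GCt : GC^T = GC by rewrite trmx_mul trmxK.
set P := _ *m C^T.
have APE : C *m F *m P = C *m invmx GC *m C^T.
  by rewrite /P !mulmxA -(mulmxA C F) -/GF mulmxK.
have PAE : P *m (C *m F) = F^T *m invmx GF *m F.
  by rewrite /P !mulmxA -(mulmxA _ C^T C) -/GC mulmxKV.
split.
- by rewrite APE !mulmxA -(mulmxA _ C^T C) -/GC mulmxKV.
- by rewrite PAE /P !mulmxA -(mulmxA _ F F^T) -/GF mulmxKV.
- by rewrite APE !trmx_mul trmxK trmx_inv GCt mulmxA.
- by rewrite PAE !trmx_mul trmxK trmx_inv GFt mulmxA.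
Qed.

Lemma mpinvP m n (A : 'M[R]_(m, n)) : is_mpinv A (mpinv A).
Proof.
suff [P AP] : exists P, is_mpinv A P by apply: (xgetI 0 AP).
rewrite -(mulmx_base A); eexists; apply: is_mpinv_factor.
  by rewrite /row_free mxrank_tr; exact: col_base_full.
exact: row_base_free.
Qed.

(* [d] is the row of diagonal entries of the diagonal factor. *)
Definition eigendecomposition l (S U : 'M[R]_l) (d : 'rV[R]_l) : Prop :=
  U^T *m U = 1%:M /\ U *m diag_mx d *m U^T = S.

Definition sqrt_diag l (d : 'rV[R]_l) : 'M[R]_l := diag_mx (map_mx Num.sqrt d).

(* The block matrix [O_{l x (n-l)}  I_l], whose width [n - l + l] is cast
   to [n]. *)
Definition zero_id_mx l n (ln : (l <= n)%N) : 'M[R]_(l, n) :=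
  castmx (erefl l, subnK ln) (row_mx 0 1%:M).

(* The two blocks [A1 A2] of [A], of widths [n - l] and [l]. *)
Definition lblock m n l (ln : (l <= n)%N) (A : 'M[R]_(m, n)) :
  'M[R]_(m, n - l) := lsubmx (castmx (erefl m, esym (subnK ln)) A).
Definition rblock m n l (ln : (l <= n)%N) (A : 'M[R]_(m, n)) :
  'M[R]_(m, l) := rsubmx (castmx (erefl m, esym (subnK ln)) A).

Lemma rank_le m n (A : 'M[R]_(m, n)) : \rank A = m -> (m <= n)%N.
Proof. by move=> <-; exact: rank_leq_col. Qed.

End Matrices.
Arguments zero_id_mx {R l n} ln.

(* Main.v *)
Require Import Defs.
From HB Require Import structures.
From mathcomp Require Import all_boot all_order all_algebra.
From mathcomp Require Import all_classical all_reals all_analysis.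
From mathcomp Require Import ring lra.

Set Implicit Arguments.
Unset Strict Implicit.
Unset Printing Implicit Defensive.

Import Order.TTheory GRing.Theory Num.Theory.
Import VectorInternalTheory.
Import numFieldNormedType.Exports.

Local Open Scope classical_set_scope.
Local Open Scope ring_scope.

(** Part (a) is separability.  The quadratic term of the big penalty ignores the
    constraint variable and is, blockwise, the weighted sum of the small
    quadratic terms, so the minimization over [v] splits
    ([gme_objective_product]): the minimum is the weighted sum of the block
    minima, attained at block minimizers together with any point of [C]
    ([is_emin_product]), and the indicator survives only in the term outside
    the minimum ([gme_product]).  Block minimizers exist because a coercive
    lower semicontinuous function attains its minimum on a large ball
    ([coercive_has_emin]), and balls are compact in finite dimension
    ([norm_ball_compact]).

    For part (b), write [S] for the Schur complement of the columns of [A1] in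
    the Gram matrix of the blocks [A1 A2].  If [P] is the orthogonal projector
    onto the column space of [A1], then [S] is the quadratic form
    [w |-> |A2 w - P (A2 w)|^2] ([schur_residual]).  So [S] is positive
    semidefinite, its eigenvalues have honest square roots, and the penalty
    contributes [theta_i S].  As a projection contracts norms,
    [|A1 u + A2 w|^2] is at least [w^T S w] for every [u], which gives the
    matrix inequality ([psdmx_scaled_penalty]).

    The small penalties are not convex in general, but the fidelity term makes
    up for it.  A small penalty is a maximum over [v], attained, of
    [Psi z - Psi v - |B (z - v)|^2 / 2].  After adding its share
    [omega_i / mu] of the quadratic fidelity term, each member of this family
    is lower semicontinuous and convex by the matrix inequality, hence so is
    the maximum ([lsc_convex_gme]).  The shares add up to the quadratic part of
    the fidelity term because the [omega_i] sum to [1], and the rest of it is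
    affine ([Gamma0_J_gme]). *)

(** * Topology of finite-dimensional Hilbert spaces *)

Lemma comp_continuous (S T U : topologicalType) (f : S -> T) (g : T -> U) :
  continuous f -> continuous g -> continuous (g \o f).
Proof. by move=> cf cg x; exact: (continuous_comp (cf x) (cg (f x))). Qed.

Section FiniteDimension.
Context (R : realType).

Lemma row_linear_continuous n (W : normedModType R)
  (f : {linear 'rV[R]_n -> W}) : continuous f.
Proof.
apply: bounded_linear_continuous; apply/linear_boundedP.
pose K : R := \sum_j `|f (delta_mx 0 j)|.
near=> r => v; apply: (@le_trans _ _ (K * `|v|)); last first.
  by rewrite ler_wpM2r//; near: r; apply: nbhs_pinfty_ge; rewrite num_real.
rewrite [in leLHS](row_sum_delta v) linear_sum /K mulr_suml.
apply: (le_trans (ler_norm_sum _ _ _)); apply: ler_sum => j _.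
rewrite linearZ normrZ mulrC ler_wpM2l// [leRHS]/Num.norm/= mx_normrE.
exact: (le_bigmax _ (fun ij : 'I_1 * 'I_n => `|v ij.1 ij.2|) (0, j)).
Unshelve. all: by end_near. Qed.

(** The norm of [V] is positive on the compact unit sphere of the coordinate
    space, so it is bounded below there, and by homogeneity everywhere.  This
    is the half of the equivalence of norms that makes coordinates continuous
    and keeps the coordinates of a bounded set bounded. *)
Lemma r2v_norm_lower (V : hilbertType R) :
  exists2 c : R, 0 < c & forall v : 'rV[R]_(dim V), c * `|v| <= `|r2v v : V|.
Proof.
pose S := [set v : 'rV[R]_(dim V) | `|v| = 1].
have cS : compact S.
  apply: bounded_closed_compact.
    by exists 1; split => // x x1 v /= ->; exact: ltW.
  have -> : S = Num.norm @^-1` [set 1] by [].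
  apply: preimage_closed => [v _|]; last exact: closed_eq.
  exact: norm_continuous.
have cf : {within S, continuous (fun v => `|r2v v : V|)}.
  apply: continuous_subspaceT.
  exact: (comp_continuous (@row_linear_continuous _ V r2v)
           (@norm_continuous _ V)).
have nzS (v : 'rV[R]_(dim V)) : v != 0 -> S (`|v|^-1 *: v).
  by move=> v0; rewrite /S/= normrZ normfV normr_id mulVf// normr_eq0.
(* The sphere is empty when [V] has dimension zero. *)
have [S0|/set0P S0] := eqVneq S set0.
  exists 1 => // v; have [->|v0] := eqVneq v 0; first by rewrite normr0 mulr0.
  by have := nzS v v0; rewrite S0.
have [u uS umin] := compact_EVT_min S0 cS cf.
exists `|r2v u : V| => [|v].
  rewrite normr_gt0 (can2_eq r2vK v2rK) linear0; apply: contraTneq uS => ->.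
  by rewrite notin_setE /S/= normr0 => /esym/eqP; rewrite oner_eq0.
have [->|v0] := eqVneq v 0; first by rewrite normr0 mulr0.
rewrite -ler_pdivlMr ?normr_gt0//.
have := umin (`|v|^-1 *: v); rewrite inE => /(_ (nzS v v0)).
by rewrite linearZ normrZ normfV normr_id mulrC.
Qed.

Lemma v2r_continuous (V : hilbertType R) : continuous (v2r : V -> _).
Proof.
have [c c0 cle] := r2v_norm_lower V.
apply: bounded_linear_continuous; apply/linear_boundedP.
near=> r => x; apply: (@le_trans _ _ (c^-1 * `|x|)); last first.
  by rewrite ler_wpM2r//; near: r; apply: nbhs_pinfty_ge; rewrite num_real.
by rewrite ler_pdivlMl// (le_trans (cle _))// v2rK.
Unshelve. all: by end_near. Qed.

Lemma hilbert_linear_continuous (V : hilbertType R) (W : normedModType R)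
  (f : {linear V -> W}) : continuous f.
Proof.
have -> : (f : V -> W) = (f \o r2v) \o v2r.
  by apply/funext => u; rewrite /= v2rK.
exact: (comp_continuous (@v2r_continuous V)
         (@row_linear_continuous _ W (f \o r2v))).
Qed.

Lemma norm_ball_compact (V : hilbertType R) (r : R) :
  compact [set x : V | `|x| <= r].
Proof.
have [c c0 cle] := r2v_norm_lower V.
have cr2v : continuous (r2v : _ -> V) by exact: row_linear_continuous.
have -> : [set x : V | `|x| <= r] = r2v @` [set v | `|r2v v : V| <= r].
  apply/seteqP; split => [x /= xr|_ [v vr <-]//].
  by exists (v2r x); rewrite /= v2rK.
apply: continuous_compact.
  by apply: continuous_subspaceT => v; exact: cr2v.
apply: bounded_closed_compact.
  exists (c^-1 * r); split=> [|x xr v /= vr]; first by rewrite num_real.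
  rewrite (le_trans _ (ltW xr))// ler_pdivlMl//; exact: le_trans vr.
rewrite (_ : mkset _ = (fun v => `|r2v v : V|) @^-1` [set y | y <= r])//.
apply: preimage_closed => [v _|]; last exact: closed_le.
move: v; exact: (comp_continuous cr2v (@norm_continuous _ V)).
Qed.

End FiniteDimension.

Section LowerSemicontinuous.
Context (R : realType).
Import finmap.
Local Open Scope ereal_scope.

(** If no point of [K] were a minimizer, every point [x] of [K] would lie in
    the open set where [f] exceeds [f u], for some [u] in [K].  Take a finite
    subcover: the index [u] at which [f] is smallest lies in none of its
    sets. *)
Lemma lsc_compact_emin (T : ptopologicalType) (f : T -> \bar R) (K : set T) :
  (forall x, -oo < f x) -> lower_semicontinuous f -> compact K -> K !=set0 ->
  exists2 c, K c & forall x, K x -> f c <= f x.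
Proof.
move=> fNy lf cK [x0 Kx0]; apply: contrapT => nomin.
have lower c : K c -> exists2 x, K x & f x < f c.
  move=> Kc; apply: contrapT => H; apply: nomin; exists c => // x Kx.
  by rewrite leNgt; apply/negP => xc; apply: H; exists x.
move: cK; rewrite compact_cover => cK.
(* An index with infinite value would contribute an empty set; leaving it out
   makes each bound real, as the openness of superlevel sets requires. *)
have [D DK Dcov] : finite_subset_cover (K `&` [set t | f t < +oo])
    (fun t => [set x | f t < f x]) K.
  apply: cK => [u [_ /= uy]|x Kx].
    have /lower_semicontinuousP/(_ (fine (f u))) := lf.
    by rewrite fineK// fin_real// fNy uy.
  have [u Ku ux] := lower x Kx.
  by exists u => //; split => //=; exact: (lt_le_trans ux (leey _)).
have [u0 u0D _] := Dcov x0 Kx0.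
have [u uD umin] : exists2 u, u \in D & forall v, v \in D -> f u <= f v.
  have [w _ wmin] :=
    @arg_minP _ _ D (FSetSub u0D) xpredT (fun v => f (val v)) isT.
  exists (val w); first exact: valP.
  by move=> v vD; exact: (wmin (FSetSub vD) isT).
have [Ku _] := set_mem (DK _ uD).
have [v vD /= vu] := Dcov u Ku.
by have := lt_le_trans vu (umin v vD); rewrite ltxx.
Qed.

End LowerSemicontinuous.

(** * Lower semicontinuity and existence of minimizers *)

Section LowerSemicontinuousCalculus.
Context (R : realType).
Local Open Scope ereal_scope.

Lemma lscD (T : topologicalType) (f g : T -> \bar R) :
  (forall x, -oo < f x) -> (forall x, -oo < g x) ->
  lower_semicontinuous f -> lower_semicontinuous g ->
  lower_semicontinuous (fun x => f x + g x).
Proof.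
move=> fNy gNy lf lg x a afg.
(* Split the slack: if both values are finite each summand gives up half of it,
   and an infinite value absorbs whatever the other summand needs. *)
have [b [c [bf cg abc]]] :
    exists b c : R, [/\ b%:E < f x, c%:E < g x & (a <= b + c)%R].
  move: (fNy x) (gNy x) afg.
  case: (f x) => [r| |]//; case: (g x) => [s| |]// _ _.
  - rewrite -EFinD lte_fin => ars.
    exists (r - (r + s - a) / 2)%R, (s - (r + s - a) / 2)%R.
    by split; rewrite ?lte_fin; lra.
  - move=> _; exists (r - 1)%R, (a - r + 1)%R.
    by split; rewrite ?lte_fin ?ltry//; lra.
  - move=> _; exists (a - s + 1)%R, (s - 1)%R.
    by split; rewrite ?lte_fin ?ltry//; lra.
  - by move=> _; exists a, 0%R; split; rewrite ?ltry//; lra.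
have [V xV Vf] := lf x b bf; have [W xW Wg] := lg x c cg.
exists (V `&` W); first exact: filterI.
move=> y [/Vf fy /Wg gy]; apply: le_lt_trans (lteD fy gy).
by rewrite -EFinD lee_fin.
Qed.

Lemma lsc_scale (T : topologicalType) (k : R) (f : T -> \bar R) : (0 < k)%R ->
  lower_semicontinuous f -> lower_semicontinuous (fun x => k%:E * f x).
Proof.
move=> k0 lf x a; rewrite -lte_pdivrMl// -EFinM => /lf[V xV Vf].
by exists V => // y /Vf; rewrite EFinM lte_pdivrMl.
Qed.

Lemma lsc_comp (S T : topologicalType) (h : S -> T) (f : T -> \bar R) :
  continuous h -> lower_semicontinuous f -> lower_semicontinuous (f \o h).
Proof.
move=> ch lf x a /lf[V xV Vf]; exists (h @^-1` V); first exact: ch.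
by move=> y /Vf.
Qed.

Lemma continuous_lsc (T : topologicalType) (f : T -> R) :
  continuous f -> lower_semicontinuous (fun x => (f x)%:E).
Proof.
move=> cf x a; rewrite lte_fin => afx; exists [set y | (a < f y)%R] => [|y].
  exact: (cf x _ (lt_nbhsr afx)).
by rewrite lte_fin.
Qed.

Lemma eindicator_ge0 (T : Type) (C : set T) z : 0 <= @eindicator R T C z.
Proof. by rewrite /eindicator; case: ifP. Qed.

Lemma eindicator_lsc (T : topologicalType) (C : set T) :
  closed C -> lower_semicontinuous (@eindicator R T C).
Proof.
move=> cC x a; rewrite /eindicator; case: ifPn => [xC a0|xC _].
  exists setT; first exact: filterT.
  by move=> y _; case: ifP => // _; rewrite ltry.
exists (~` C); first by apply: open_nbhs_nbhs; split;
  [exact: closed_openC | rewrite notin_setE in xC].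
by move=> y yC; rewrite memNset// ltry.
Qed.

(** A strict lower bound at [x] is inherited from the member of the family
    that attains the maximum at [x], because the maximum dominates that member
    at every point. *)
Lemma lsc_attained_max (T : topologicalType) (I : Type) (f : T -> \bar R)
    (h : I -> T -> \bar R) :
  (forall i, lower_semicontinuous (h i)) -> (forall i x, h i x <= f x) ->
  (forall x, exists i, f x = h i x) -> lower_semicontinuous f.
Proof.
move=> lh hf fh x a; have [i ->] := fh x => /lh[V xV Vh]; exists V => // y Vy.
exact: lt_le_trans (Vh y Vy) (hf i y).
Qed.

End LowerSemicontinuousCalculus.

Lemma sqr_dist_linear_continuous (R : realType) (V W : hilbertType R)
    (f : {linear V -> W}) (u : W) (k : R) :
  continuous (fun x => k * `|u - f x| ^+ 2).
Proof.
have sqr_continuous : continuous (fun a : R => k * a ^+ 2).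
  by move=> a; apply: cvgM; [exact: cvg_cst | exact: exprn_continuous].
have sub_continuous : continuous (fun w : W => u - w).
  by move=> w; apply: cvgB; [exact: cvg_cst | exact: cvg_id].
have := comp_continuous (@norm_continuous R W) sqr_continuous.
move=> /(comp_continuous sub_continuous).
exact: (comp_continuous (@hilbert_linear_continuous R V W f)).
Qed.

Section Minimum.
Context (R : realType).
Local Open Scope ereal_scope.

Lemma is_emin_emin (A : set (\bar R)) m : is_emin A m -> emin A = m.
Proof.
move=> mA; apply: xget_unique => // m' [Am' lm']; case: mA => Am lm.
by apply/eqP; rewrite eq_le lm'// lm.
Qed.

(** Outside a large enough ball, coercivity makes [f] exceed its value at a
    point of the domain; the ball is compact, and the minimizer over it is then
    global. *)
Lemma coercive_has_emin (H : hilbertType R) (f : H -> \bar R) :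
  eproper f -> lower_semicontinuous f -> coercive f -> has_emin (range f).
Proof.
move=> [fNy [z0 z0f]] lf cf.
have f0 : f z0 = (fine (f z0))%:E by rewrite fineK// fin_real// fNy.
have [r rf] := cf (fine (f z0)).
pose K := [set x : H | (`|x| <= Num.max r `|z0|)%R].
have Kz0 : K z0 by rewrite /K/= le_max lexx orbT.
have [c _ cmin] := lsc_compact_emin fNy lf (@norm_ball_compact R H _)
  (ex_intro _ z0 Kz0).
exists (f c); split; first by exists c.
move=> _ [x _ <-]; have [xK|xK] := leP `|x|%R (Num.max r `|z0|)%R.
  exact: cmin.
apply: (le_trans (cmin _ Kz0)); rewrite f0; apply/ltW/rf.
by move: xK; rewrite gt_max => /andP[].
Qed.

Lemma gme_objective_has_emin (W Wt : hilbertType R) (F : W -> \bar R)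
    (M : {linear W -> Wt}) (z : W) :
  eproper F -> lower_semicontinuous F -> coercive F ->
  has_emin (range (gme_objective F M z)).
Proof.
move=> [FNy [z0 z0F]] lF cF.
have pen_ge0 v : 0 <= (2^-1 * `|M (z - v)%R| ^+ 2)%:E.
  by rewrite lee_fin mulr_ge0// sqr_ge0.
have FE v : F v <= gme_objective F M z v by exact: leeDl.
apply: coercive_has_emin.
- split=> [v|]; first exact: lt_le_trans (FNy v) (FE v).
  by exists z0; rewrite /edom/= /gme_objective lte_add_pinfty// ltry.
- apply: lscD => // [v|]; first exact: ltNyr.
  under eq_fun do rewrite linearB.
  by apply: continuous_lsc; exact: sqr_dist_linear_continuous.
- by move=> a; have [r rF] := cF a; exists r => v /rF /lt_le_trans; exact.
Qed.

End Minimum.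

(** * Lower semicontinuous convex functions *)

Section InnerProduct.
Context (R : realType) (H : hilbertType R).
Implicit Types x y z : H.

Lemma hnormDZ_sqr (s t : R) x y :
  `|s *: x + t *: y| ^+ 2 =
  s ^+ 2 * `|x| ^+ 2 + 2 * s * t * inner x y + t ^+ 2 * `|y| ^+ 2.
Proof.
rewrite -!inner_normE innerDl !(innerC _ (_ + _)) !innerDl !innerZl.
rewrite !(innerC _ (_ *: _)) !innerZl (innerC y x); ring.
Qed.

Lemma hnorm_convex_comb (t : R) x y :
  `|t *: x + (1 - t) *: y| ^+ 2 =
  t * `|x| ^+ 2 + (1 - t) * `|y| ^+ 2 - t * (1 - t) * `|x - y| ^+ 2.
Proof.
have -> : x - y = 1 *: x + (-1) *: y by rewrite scale1r scaleN1r.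
by rewrite !hnormDZ_sqr; ring.
Qed.

End InnerProduct.

Section LscConvex.
Context (R : realType).
Local Open Scope ereal_scope.

(** This is membership in [Gamma0] without the nonempty domain, the one
    condition that a sum of two such functions can lose. *)
Definition lsc_convex (H : hilbertType R) (f : H -> \bar R) : Prop :=
  [/\ (forall z, -oo < f z), lower_semicontinuous f & econvex f].

Lemma lsc_convexD (H : hilbertType R) (f g : H -> \bar R) :
  lsc_convex f -> lsc_convex g -> lsc_convex (fun x => f x + g x).
Proof.
move=> [fNy lf cf] [gNy lg cg]; split; [|exact: lscD|].
  by move=> z; rewrite lteNye adde_eq_ninfty negb_or -!lteNye fNy gNy.
move=> x y t t01; apply: (le_trans (leeD (cf x y t t01) (cg x y t t01))).
by rewrite !muleDr ?ltninfty_adde_def ?inE// addeACA.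
Qed.

Lemma lsc_convex_scale (H : hilbertType R) (k : R) (f : H -> \bar R) :
  (0 < k)%R -> lsc_convex f -> lsc_convex (fun x => k%:E * f x).
Proof.
move=> k0 [fNy lf cf]; split; [|exact: lsc_scale|].
  move=> z; have := fNy z; case: (f z) => [r| |]//= _.
    by rewrite -EFinM ltNyr.
  by rewrite gt0_muley ?lte_fin.
move=> x y t t01; have k0' : 0 <= k%:E by rewrite lee_fin ltW.
apply: (le_trans (lee_wpmul2l k0' (cf x y t t01))); case/andP: t01 => t0 t1.
have NyM (s : R) z : (0 < s)%R -> -oo < s%:E * f z.
  move=> s0; have := fNy z; case: (f z) => [r| |]//= _.
    by rewrite -EFinM ltNyr.
  by rewrite gt0_muley ?lte_fin.
rewrite muleDr ?ltninfty_adde_def ?inE ?NyM ?subr_gt0//.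
by rewrite !muleA !(muleC k%:E).
Qed.

Lemma lsc_convex_sum (H : hilbertType R) (I : Type) (s : seq I)
    (f : I -> H -> \bar R) :
  (forall i, lsc_convex (f i)) -> lsc_convex (fun x => \sum_(i <- s) f i x).
Proof.
move=> lcf; elim: s => [|i s IHs].
  under eq_fun do rewrite big_nil.
  split=> [z||x y t _]; first exact: ltNyr.
    by apply: continuous_lsc => x; exact: cvg_cst.
  by rewrite !mule0 adde0.
by under eq_fun do rewrite big_cons; exact: lsc_convexD.
Qed.

Lemma lsc_convex_comp (H K : hilbertType R) (L : {linear H -> K})
    (f : K -> \bar R) : lsc_convex f -> lsc_convex (f \o L).
Proof.
move=> [fNy lf cf]; split=> [z||x y t t01]; first exact: fNy.
  by apply: lsc_comp => //; exact: hilbert_linear_continuous.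
by rewrite /= linearP linearZ; exact: cf.
Qed.

(** Convexity between [x] and [y] only has to be checked for the member of the
    family that attains the maximum at the intermediate point. *)
Lemma lsc_convex_attained_max (H : hilbertType R) (I : Type) (f : H -> \bar R)
    (h : I -> H -> \bar R) :
  (forall i, lsc_convex (h i)) -> (forall i x, h i x <= f x) ->
  (forall x, exists i, f x = h i x) -> lsc_convex f.
Proof.
move=> lch hf fh; split=> [x||x y t t01].
- by have [i ->] := fh x; have [+ _ _] := lch i; exact.
- by apply: lsc_attained_max hf fh => i; have [] := lch i.
have [i ->] := fh (t *: x + (1 - t) *: y)%R; have [_ _ ch] := lch i.
have [/ltW t0 /ltW t1] := andP t01.
apply: (le_trans (ch x y t t01)); apply: leeD; apply: lee_wpmul2l => //.
by rewrite lee_fin subr_ge0.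
Qed.

Lemma lsc_convex_eindicator (H : hilbertType R) (C : set H) :
  closed C -> convex_set (C : set (convex_lmodType H)) ->
  lsc_convex (@eindicator R H C).
Proof.
move=> cC vC; split=> [z||x y t /andP[t0 t1]].
- exact: lt_le_trans (ltNyr 0) (eindicator_ge0 _ _ _).
- exact: eindicator_lsc.
have iNy z : -oo < @eindicator R H C z.
  exact: lt_le_trans (ltNyr 0) (eindicator_ge0 _ _ _).
have s0 : (0 < 1 - t)%R by rewrite subr_gt0.
have ge0M (s : R) z : (0 < s)%R -> 0 <= s%:E * @eindicator R H C z.
  by move=> /ltW s0'; rewrite mule_ge0// eindicator_ge0.
have [xC|xC] := boolP (x \in C); last first.
  rewrite {2}/eindicator (negbTE xC) gt0_muley ?lte_fin//.
  by rewrite addye ?leey// gt_eqF// (lt_le_trans _ (ge0M _ _ s0))// ltNyr.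
have [yC|yC] := boolP (y \in C); last first.
  rewrite {3}/eindicator (negbTE yC) gt0_muley ?lte_fin//.
  by rewrite addey ?leey// gt_eqF// (lt_le_trans _ (ge0M _ _ t0))// ltNyr.
have := vC x y (Itv01 (ltW t0) (ltW t1)) xC yC.
rewrite /eindicator xC yC !mule0 adde0 => xyC.
by rewrite ifT.
Qed.

(** The gap in the convexity inequality of [x |-> `|u - A x| ^+ 2] between [x]
    and [y] is [t * (1 - t) * `|A (x - y)| ^+ 2], whatever [u] is.  Hence the
    difference of two such functions is convex as soon as the linear parts are
    ordered, and the centres [u] and [v] are free. *)
Lemma lsc_convex_sqr_distB (X Y Z : hilbertType R) (A : {linear X -> Y})
    (D : {linear X -> Z}) (u : Y) (v : Z) (a b c : R) :
  (forall x, b * `|D x| ^+ 2 <= a * `|A x| ^+ 2)%R ->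
  lsc_convex (fun x => (a * `|u - A x| ^+ 2 - b * `|v - D x| ^+ 2 + c)%:E).
Proof.
move=> DA; split=> [x||x y t /andP[t0 t1]]; first exact: ltNyr.
  apply: continuous_lsc => x; apply: cvgD; last exact: cvg_cst.
  by apply: cvgB; exact: sqr_dist_linear_continuous.
have affine (V W : hilbertType R) (f : {linear V -> W}) (w : W) p q :
    (w - f (t *: p + (1 - t) *: q) =
     t *: (w - f p) + (1 - t) *: (w - f q))%R.
  rewrite linearP linearZ/= !scalerBr addrACA -scalerDl.
  by rewrite subrKC scale1r opprD.
rewrite -!EFinM -EFinD lee_fin !affine !hnorm_convex_comb.
have diff (V W : hilbertType R) (f : {linear V -> W}) (w : W) p q :
    (w - f p - (w - f q) = f (q - p))%R.
  by rewrite [RHS]linearB opprB addrC subrKA.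
rewrite !diff; have := DA (y - x)%R.
set dA := (`|A _| ^+ 2)%R; set dD := (`|D _| ^+ 2)%R => DA'.
have ts : (0 <= t * (1 - t))%R by rewrite mulr_ge0 ?subr_ge0 ?ltW.
have := ler_wpM2l ts DA'; rewrite -subr_ge0 => h.
rewrite -subr_ge0; apply: (le_trans h); rewrite le_eqVlt; apply/orP; left.
by apply/eqP; ring.
Qed.

End LscConvex.

(** * Separability and convexity of the penalties *)

Section ProductPenalty.
Context (R : realType) (M : nat) (fZ : hilbertType R).
Context (Z Zt : 'I_M -> hilbertType R).
Context (Psi : forall i, Z i -> \bar R) (mus : 'I_M -> R).
Context (B : forall i, {linear Z i -> Zt i}) (C : set fZ).
Arguments Psi : clear implicits.
Hypothesis mus_gt0 : forall i, 0 < mus i.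
Local Open Scope ereal_scope.

Implicit Types z v : hpair (hprod Z) fZ.

Let bPsi := add_constraint (weighted_sum mus Psi) C.
Let Bc := zero_ext (W := fZ) (weighted_op mus B).

(** The second component of [Bc] is zero, so the quadratic term does not see
    the constraint variable, and the weights [sqrt mu_i] of the operator turn
    into the weights [mu_i] of the penalties: the minimization problem splits
    into one problem for each block and the constraint. *)
Lemma gme_objective_product z v :
  gme_objective bPsi Bc z v =
  \sum_i (mus i)%:E * gme_objective (Psi i) (B i) (z.1 i) (v.1 i)
  + eindicator C v.2.
Proof.
have subE i : ((z - v)%R.1 : hprod Z) i = (z.1 i - v.1 i)%R.
  by rewrite -scaleN1r hprodDE hprodZE scaleN1r.
have penE : (2^-1 * `|Bc (z - v)%R| ^+ 2)%R =
    (\sum_i mus i * (2^-1 * `|B i (z.1 i - v.1 i)| ^+ 2))%R.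
  rewrite -inner_normE [inner _ _]/(hpair_inner _ _) /hpair_inner/=.
  rewrite [inner _ _ in X in (X + _)%R]/(hprod_inner _ _).
  rewrite inner_normE normr0 expr0n addr0 mulr_sumr; apply: eq_bigr => i _.
  rewrite ffunE subE inner_normE normrZ exprMn ger0_norm ?sqrtr_ge0//.
  by rewrite sqr_sqrtr ?ltW//; ring.
rewrite /gme_objective penE /bPsi /add_constraint /weighted_sum addeAC.
congr (_ + _).
rewrite -sumEFin -big_split; apply: eq_bigr => i _ /=.
by rewrite EFinM muleDr// fin_num_adde_defl.
Qed.

(** By separability, a minimizer is obtained from a minimizer in each block and
    an arbitrary point of [C]. *)
Lemma is_emin_product z (m : 'I_M -> \bar R) : C !=set0 ->
  (forall i, is_emin (range (gme_objective (Psi i) (B i) (z.1 i))) (m i)) ->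
  is_emin (range (gme_objective bPsi Bc z)) (\sum_i (mus i)%:E * m i).
Proof.
move=> [c0 Cc0] mP; pose v i := cid2 (proj1 (mP i)).
split=> [|_ [w _ <-]]; rewrite ?gme_objective_product.
  exists ((finfun (fun i => s2val (v i)) : hprod Z, c0) : hpair _ _) => //.
  rewrite gme_objective_product /eindicator/= mem_set// adde0.
  by apply: eq_bigr => i _; rewrite ffunE (s2valP' (v i)).
apply: (@le_trans _ _ (\sum_i (mus i)%:E *
    gme_objective (Psi i) (B i) (z.1 i) (w.1 i))).
  apply: lee_sum => i _; apply: lee_wpmul2l; first by rewrite lee_fin ltW.
  by apply: (mP i).2; exists (w.1 i).
by rewrite leeDl// eindicator_ge0.
Qed.

Lemma gme_product z : C !=set0 -> (forall i x, Psi i x \is a fin_num) ->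
  (forall i, has_emin (range (gme_objective (Psi i) (B i) (z.1 i)))) ->
  gme bPsi Bc z =
  \sum_i (mus i)%:E * gme (Psi i) (B i) (z.1 i) + eindicator C z.2.
Proof.
move=> C0 Psi_fin hm; pose m i := projT1 (cid (hm i)).
have mP i : is_emin (range (gme_objective (Psi i) (B i) (z.1 i))) (m i).
  exact: projT2 (cid (hm i)).
have m_fin i : m i \is a fin_num.
  by have [[v _ <-] _] := mP i; rewrite fin_numD Psi_fin.
rewrite /gme (is_emin_emin (is_emin_product C0 mP)).
rewrite /bPsi /add_constraint /weighted_sum addeAC; congr (_ + _).
rewrite -fin_num_sumeN => [|i _]; last by rewrite fin_numM.
rewrite -big_split; apply: eq_bigr => i _ /=.
by rewrite (is_emin_emin (mP i)) muleBr// fin_num_adde_defr.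
Qed.

End ProductPenalty.

Section ScaledGme.
Context (R : realType).
Local Open Scope ereal_scope.

(** Subtracting an attained minimum is taking an attained maximum: this is the
    form in which the penalty meets [lsc_convex_attained_max]. *)
Lemma gme_attained (W Wt : hilbertType R) (p : W -> R)
    (T : {linear W -> Wt}) (z : W) :
  has_emin (range (gme_objective (EFin \o p) T z)) ->
  exists2 v, gme (EFin \o p) T z = (p z - (p v + 2^-1 * `|T (z - v)| ^+ 2))%:E &
    forall w,
      (p z - (p w + 2^-1 * `|T (z - w)| ^+ 2))%:E <= gme (EFin \o p) T z.
Proof.
move=> [_ [[v _ <-] vmin]].
have gmeE : gme (EFin \o p) T z = (p z - (p v + 2^-1 * `|T (z - v)| ^+ 2))%:E.
  by rewrite /gme (@is_emin_emin _ _ (gme_objective (EFin \o p) T z v)).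
exists v => // w; rewrite gmeE lee_fin lerD2l lerN2.
by rewrite -lee_fin; apply: vmin; exists w.
Qed.

(** The function is the attained maximum over [v] of the functions [h v] below.
    Each is the sum of [k * p (L x)] and of a difference of two quadratics,
    which is convex because the quadratic part of the fidelity term dominates
    the one that the penalty subtracts. *)
Lemma lsc_convex_gme (X Y W Wt : hilbertType R) (A : {linear X -> Y})
    (L : {linear X -> W}) (T : {linear W -> Wt}) (p : W -> R) (k a : R) :
  (0 < k)%R -> lsc_convex (EFin \o p) ->
  (forall z, has_emin (range (gme_objective (EFin \o p) T z))) ->
  (forall x, k * `|T (L x)| ^+ 2 <= a * `|A x| ^+ 2)%R ->
  lsc_convex (fun x => (2^-1 * (a * `|A x| ^+ 2))%:E
                       + k%:E * gme (EFin \o p) T (L x)).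
Proof.
move=> k0 lcp hmin TA.
pose h v x := k%:E * (p (L x))%:E
  + (2^-1 * a * `|0 - A x| ^+ 2 - 2^-1 * k * `|T v - (T \o L) x| ^+ 2
     + - (k * p v))%:E.
have hE v x : h v x = (2^-1 * (a * `|A x| ^+ 2))%:E
    + k%:E * (p (L x) - (p v + 2^-1 * `|T (L x - v)| ^+ 2))%:E.
  rewrite /h -!EFinM -!EFinD sub0r normrN linearB (distrC (T v)) /=.
  by congr EFin; ring.
apply: (lsc_convex_attained_max (h := h)) => [v|v x|x].
- apply: lsc_convexD.
    by apply: lsc_convex_scale => //; exact: (lsc_convex_comp L lcp).
  apply: lsc_convex_sqr_distB => x /=.
  by rewrite -!mulrA ler_wpM2l// invr_ge0.
- have [_ _ vmax] := gme_attained (hmin (L x)).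
  by rewrite hE leeD2l// lee_wpmul2l// lee_fin ltW.
- by have [v gmeE _] := gme_attained (hmin (L x)); exists v; rewrite hE gmeE.
Qed.

End ScaledGme.

(** * Schur complements *)

Section SchurComplement.
Context (R : realType).

Lemma dotmx_ge0 n (v : 'cV[R]_n) : 0 <= (v^T *m v) 0 0.
Proof. by rewrite mxE sumr_ge0// => i _; rewrite mxE -expr2 sqr_ge0. Qed.

Lemma quadformBZ n (v : 'cV[R]_n) (G H : 'M[R]_n) (t : R) :
  (v^T *m (G - t *: H) *m v) 0 0 =
  (v^T *m G *m v) 0 0 - t * (v^T *m H *m v) 0 0.
Proof.
rewrite mulmxBr mulmxBl -scalemxAr -scalemxAl.
by rewrite [LHS]mxE [X in _ + X]mxE [X in - X]mxE.
Qed.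

Lemma mpinv_tr n (G : 'M[R]_n) : G^T = G -> (mpinv G)^T = mpinv G.
Proof.
move=> Gt; have [P1 P2 P3 P4] := mpinvP G.
apply: is_mpinv_uniq (mpinvP G); split.
- by have := congr1 trmx P1; rewrite !trmx_mul Gt mulmxA.
- by have := congr1 trmx P2; rewrite !trmx_mul Gt mulmxA.
- by rewrite trmx_mul trmxK Gt -[LHS]P4 trmx_mul Gt.
- by rewrite trmx_mul trmxK Gt -[LHS]P3 trmx_mul Gt.
Qed.

(** The orthogonal projector onto the column space of [A]. *)
Definition range_proj m p (A : 'M[R]_(m, p)) : 'M[R]_m :=
  A *m mpinv (A^T *m A) *m A^T.

Lemma range_proj_tr m p (A : 'M[R]_(m, p)) : (range_proj A)^T = range_proj A.
Proof.
by rewrite !trmx_mul trmxK mpinv_tr ?mulmxA// trmx_mul trmxK.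
Qed.

Lemma mxgram_eq0 m p (A : 'M[R]_(m, p)) : A^T *m A = 0 -> A = 0.
Proof.
move=> AA; apply/matrixP => i j; rewrite [RHS]mxE; apply/eqP.
have := congr1 (fun X : 'M[R]_p => X j j) AA; rewrite !mxE => /eqP.
rewrite psumr_eq0 => [/allP/(_ i (mem_index_enum _))|k _]; rewrite mxE.
  by rewrite mulf_eq0 orbb.
by rewrite -expr2 sqr_ge0.
Qed.

(** The residual [range_proj A *m A - A] is orthogonal to the columns of [A] by
    the first Penrose equation, and its own columns lie in their span, so its
    Gram matrix vanishes. *)
Lemma range_projK m p (A : 'M[R]_(m, p)) : range_proj A *m A = A.
Proof.
have [P1 _ _ _] := mpinvP (A^T *m A).
apply/eqP; rewrite -subr_eq0; apply/eqP/mxgram_eq0.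
have AA0 : A^T *m (range_proj A *m A - A) = 0.
  by rewrite mulmxBr /range_proj !mulmxA -(mulmxA _ A^T A) P1 subrr.
rewrite [(_ - _)^T]linearB/= mulmxBl AA0 subr0 trmx_mul range_proj_tr.
by rewrite -mulmxA {1}/range_proj -(mulmxA _ A^T) AA0 !mulmx0.
Qed.

Lemma range_proj_idem m p (A : 'M[R]_(m, p)) :
  range_proj A *m range_proj A = range_proj A.
Proof. by rewrite {2}/range_proj !mulmxA range_projK. Qed.

Lemma range_proj_contract m p (A : 'M[R]_(m, p)) (x : 'cV[R]_m) :
  ((x - range_proj A *m x)^T *m (x - range_proj A *m x)) 0 0
    <= (x^T *m x) 0 0.
Proof.
move: (range_proj A) (range_proj_tr A) (range_proj_idem A) => P Pt PP.
set y := x - P *m x.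
have orth : (P *m x)^T *m y = 0.
  by rewrite trmx_mul Pt /y mulmxBr !mulmxA -(mulmxA _ P P) PP subrr.
have orth' : y^T *m (P *m x) = 0.
  by rewrite -[LHS]trmxK trmx_mul trmxK orth trmx0.
have xE : x = y + P *m x by rewrite subrK.
clearbody y; have -> : x^T *m x = y^T *m y + (P *m x)^T *m (P *m x).
  rewrite {1 2}xE [(_ + _)^T]linearD/= mulmxDl !mulmxDr orth orth'.
  by rewrite addr0 add0r.
by rewrite [leRHS]mxE lerDl dotmx_ge0.
Qed.

(** The Schur complement is [A2^T *m (1 - P) *m A2] with [P] the projector onto
    the column space of [A1], and [1 - P] is symmetric and idempotent, hence its
    own Gram matrix. *)
Lemma schur_residual m p l (A1 : 'M[R]_(m, p)) (A2 : 'M[R]_(m, l))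
    (w : 'cV[R]_l) :
  let y := A2 *m w - range_proj A1 *m (A2 *m w) in
  w^T *m (A2^T *m A2 - A2^T *m A1 *m mpinv (A1^T *m A1) *m A1^T *m A2) *m w =
  y^T *m y.
Proof.
move=> y; rewrite (_ : _ *m A1 *m _ *m A1^T *m A2 =
    A2^T *m range_proj A1 *m A2); last by rewrite !mulmxA.
rewrite /y {y}.
move: (range_proj A1) (range_proj_tr A1) (range_proj_idem A1) => P Pt PP.
set y := A2 *m w - P *m (A2 *m w).
have Py : P *m y = 0 by rewrite mulmxBr (mulmxA P P) PP subrr.
have yE : y = A2 *m w - P *m (A2 *m w) by [].
clearbody y; rewrite {1}yE [(A2 *m w - _)^T]linearB/= (mulmxBl (A2 *m w)^T).
rewrite (trmx_mul P) Pt -(mulmxA _ P y) Py mulmx0 subr0 trmx_mul yE.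
by rewrite !(mulmxBr, mulmxBl) !mulmxA.
Qed.

(** The lower block of [x] is [zero_id_mx ln *m x]; [u] is the upper block. *)
Lemma mulmx_blocks m n l (ln : (l <= n)%N) (A : 'M[R]_(m, n)) (x : 'cV[R]_n) :
  exists u, A *m x = lblock ln A *m u + rblock ln A *m (zero_id_mx ln *m x).
Proof.
rewrite /lblock /rblock /zero_id_mx.
move: (n - l)%N (subnK ln) => p e; case: n / e A x {ln} => A x.
rewrite !castmx_id; exists (usubmx x).
rewrite -{1}(hsubmxK A) -{1 3}(vsubmxK x) !mul_row_col mul0mx add0r mul1mx.
by [].
Qed.

(** [d 0 j] is the value of the quadratic form of [S] at the [j]-th
    eigenvector, the [j]-th column of [U].  Nonnegativity matters because the
    real square root of a negative eigenvalue would be [0]. *)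
Lemma eigenvalue_ge0 l (S U : 'M[R]_l) (d : 'rV[R]_l) :
  eigendecomposition S U d ->
  (forall w : 'cV[R]_l, 0 <= (w^T *m S *m w) 0 0) -> forall j, 0 <= d 0 j.
Proof.
move=> [UU USU] Sge0 j.
pose e : 'cV[R]_l := U *m delta_mx j 0.
have -> : d 0 j = (e^T *m S *m e) 0 0.
  rewrite /e -USU trmx_mul -!mulmxA (mulmxA U^T U) UU mul1mx.
  rewrite (mulmxA U^T U) UU mul1mx.
  rewrite trmx_delta mul_diag_mx -rowE.
  by rewrite !mxE !eqxx mulr1.
exact: Sge0.
Qed.

Lemma sqrt_factor_gram l (S U : 'M[R]_l) (d : 'rV[R]_l) :
  eigendecomposition S U d -> (forall j, 0 <= d 0 j) ->
  (sqrt_diag d *m U^T)^T *m (sqrt_diag d *m U^T) = S.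
Proof.
move=> [_ USU] d_ge0; rewrite trmx_mul trmxK tr_diag_mx -USU !mulmxA.
congr (_ *m _); rewrite -mulmxA; congr (_ *m _).
apply/matrixP => i j; rewrite mul_diag_mx !mxE; case: eqP => [->|_].
  by rewrite !mulr1n -expr2 sqr_sqrtr.
by rewrite !mulr0n mulr0.
Qed.

(** With [w := L *m v], the penalty contributes [t] times the Schur complement
    form at [w], while [s *: A *m v = A1 *m u + A2 *m w] for some [u].
    Projecting this vector off the columns of [A1] does not increase its norm,
    erases the [u] part, and leaves exactly the residual whose squared norm is
    the Schur complement form. *)
Lemma psdmx_scaled_penalty m n l (ln : (l <= n)%N) (A : 'M[R]_(m, n))
    (L : 'M[R]_(l, n)) (Lt : 'M[R]_n) (U : 'M[R]_l) (d : 'rV[R]_l)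
    (s k t : R) :
  Lt \in unitmx -> zero_id_mx ln *m Lt = L -> 0 < k -> 0 <= t <= 1 ->
  let At := s *: (A *m invmx Lt) in
  let A1 := lblock ln At in let A2 := rblock ln At in
  eigendecomposition (A2^T *m A2
    - A2^T *m A1 *m mpinv (A1^T *m A1) *m A1^T *m A2) U d ->
  let B := Num.sqrt (t / k) *: (sqrt_diag d *m U^T) in
  psdmx ((s *: A)^T *m (s *: A) - k *: (L^T *m B^T *m B *m L)).
Proof.
move=> Ltu LtL k0 /andP[t0 t1] At A1 A2 SUd B.
set S := (X in eigendecomposition X) in SUd.
have S_ge0 (w : 'cV[R]_l) : 0 <= (w^T *m S *m w) 0 0.
  by rewrite /S schur_residual dotmx_ge0.
have BB : B^T *m B = (t / k) *: S.
  rewrite /B [(_ *: _)^T]linearZ/= -scalemxAl -scalemxAr scalerA -expr2.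
  rewrite sqr_sqrtr; last by rewrite divr_ge0// ltW.
  by rewrite (sqrt_factor_gram SUd (eigenvalue_ge0 SUd S_ge0)).
have gramB : k *: (L^T *m B^T *m B *m L) = t *: (L^T *m S *m L).
  rewrite -(mulmxA L^T B^T B) BB -scalemxAr -scalemxAl scalerA.
  by rewrite mulrCA mulfV ?mulr1// gt_eqF.
split.
  have gramT p (X : 'M[R]_(p, n)) : (X^T *m X)^T = X^T *m X.
    by rewrite trmx_mul trmxK.
  have -> : L^T *m B^T *m B *m L = (B *m L)^T *m (B *m L).
    by rewrite trmx_mul !mulmxA.
  by rewrite [LHS]linearB/= [(k *: _)^T]linearZ/= !gramT.
move=> v; rewrite gramB.
rewrite quadformBZ subr_ge0.
have -> : v^T *m (L^T *m S *m L) *m v = (L *m v)^T *m S *m (L *m v).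
  by rewrite trmx_mul !mulmxA.
have -> : v^T *m ((s *: A)^T *m (s *: A)) *m v =
    ((s *: A) *m v)^T *m ((s *: A) *m v).
  by rewrite trmx_mul !mulmxA.
have [u Au] := mulmx_blocks ln At (Lt *m v).
have sAE : (s *: A) *m v = A1 *m u + A2 *m (L *m v).
  rewrite -LtL -(mulmxA _ Lt) -Au /At -!scalemxAl; congr (_ *: _).
  by rewrite mulmxA mulmxKV.
apply: (@le_trans _ _ (((L *m v)^T *m S *m (L *m v)) 0 0)).
  by rewrite ler_piMl.
rewrite /S schur_residual sAE.
have := range_proj_contract A1 (A1 *m u + A2 *m (L *m v)).
rewrite mulmxDr (mulmxA _ A1) range_projK.
by rewrite opprD addrACA subrr add0r.
Qed.

Lemma psdmx_gram_le m n l p (A : 'M[R]_(m, n)) (L : 'M[R]_(l, n))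
    (B : 'M[R]_(p, l)) (s k : R) :
  psdmx ((s *: A)^T *m (s *: A) - k *: (L^T *m B^T *m B *m L)) ->
  forall v : 'cV[R]_n,
  k * ((B *m (L *m v))^T *m (B *m (L *m v))) 0 0
    <= s ^+ 2 * ((A *m v)^T *m (A *m v)) 0 0.
Proof.
move=> [_ psd] v; have := psd v; rewrite quadformBZ subr_ge0.
have -> : v^T *m (L^T *m B^T *m B *m L) *m v =
    (B *m (L *m v))^T *m (B *m (L *m v)) by rewrite !trmx_mul !mulmxA.
have -> : v^T *m ((s *: A)^T *m (s *: A)) *m v =
    s ^+ 2 *: ((A *m v)^T *m (A *m v)).
  rewrite mulmxA -trmx_mul -mulmxA -!scalemxAl [(_ *: _)^T]linearZ/=.
  by rewrite -scalemxAl -scalemxAr scalerA.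
by rewrite [leRHS]mxE.
Qed.

End SchurComplement.

(** * Convexity of the regularized least-squares cost *)

Section ModelConvexity.
Context (R : realType) (M : nat) (X fZ : hilbertType R).
Context (Z Zt : 'I_M -> hilbertType R).
Context (Psi : forall i, Z i -> \bar R) (mus : 'I_M -> R).
Arguments Psi : clear implicits.
Context (B : forall i, {linear Z i -> Zt i}) (L : forall i, {linear X -> Z i}).
Context (C : set fZ) (fC : {linear X -> fZ}).
Hypothesis Psi_Gamma0 : forall i, Gamma0 (Psi i).
Hypothesis Psi_coercive : forall i, coercive (Psi i).
Hypothesis Psi_dom : forall i, edom (Psi i) = setT.
Hypothesis mus_gt0 : forall i, 0 < mus i.
Hypothesis C_neq0 : C !=set0.
Local Open Scope ereal_scope.

Let bPsi := add_constraint (weighted_sum mus Psi) C.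
Let Bc := zero_ext (W := fZ) (weighted_op mus B).
Let Lc := pair_op (hprod_stack L) fC.

Let Psi_fin i z : Psi i z \is a fin_num.
Proof.
have [[PsiNy _] _ _] := Psi_Gamma0 i; rewrite fin_real// PsiNy/=.
by have : edom (Psi i) z by rewrite Psi_dom.
Qed.

Lemma penalty_has_emin i z :
  has_emin (range (gme_objective (Psi i) (B i) z)).
Proof. by have [Pp Pl _] := Psi_Gamma0 i; exact: gme_objective_has_emin. Qed.

Lemma constrained_penalty_has_emin z :
  has_emin (range (gme_objective bPsi Bc z)).
Proof.
pose m i := projT1 (cid (penalty_has_emin (z.1 i))).
exists (\sum_i (mus i)%:E * m i); apply: is_emin_product => // i.
exact: projT2 (cid (penalty_has_emin (z.1 i))).
Qed.

Lemma gme_constrained_comp :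
  gme bPsi Bc \o Lc =
  (fun x => \sum_i (mus i)%:E * (gme (Psi i) (B i) \o L i) x
            + (eindicator C \o fC) x).
Proof.
apply/funext => x; rewrite /= gme_product// => [|i].
  by congr (_ + _); apply: eq_bigr => i _; rewrite ffunE.
exact: penalty_has_emin.
Qed.

(** Since the [omega i] sum to [1], the quadratic part of the fidelity term can
    be shared out among the blocks, each of which uses its share to compensate
    the concave part of its own penalty; what remains of the fidelity term is
    affine. *)
Lemma Gamma0_J_gme (Y : hilbertType R) (y : Y) (A : {linear X -> Y}) (mu : R)
    (omega : 'I_M -> R) :
  C `&` range fC !=set0 -> (0 < mu)%R -> (\sum_i omega i = 1)%R ->
  closed C -> convex_set (C : set (convex_lmodType fZ)) ->
  (forall i x,
    mus i * `|B i (L i x)| ^+ 2 <= omega i / mu * `|A x| ^+ 2)%R ->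
  Gamma0 (J y A mu (gme bPsi Bc \o Lc)).
Proof.
move=> [c [Cc [x0 _ x0c]]] mu0 omega1 cC vC BA.
pose p i z := fine (Psi i z).
have PsiE i : Psi i = EFin \o p i.
  by apply/funext => z; rewrite /= /p fineK.
have gme_fin i z : gme (Psi i) (B i) z \is a fin_num.
  have := @penalty_has_emin i z; rewrite PsiE.
  by move=> /gme_attained[v -> _].
pose g x := (\sum_i mus i * fine (gme (Psi i) (B i) (L i x)))%R.
have gE x : \sum_i (mus i)%:E * (gme (Psi i) (B i) \o L i) x = (g x)%:E.
  by rewrite -sumEFin; apply: eq_bigr => i _; rewrite EFinM fineK.
pose q i x := (2^-1 * (omega i / mu * `|A x| ^+ 2))%:E
              + (mus i)%:E * gme (Psi i) (B i) (L i x).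
have qE x : \sum_i q i x = ((2 * mu)^-1 * `|A x| ^+ 2 + g x)%:E.
  rewrite big_split gE sumEFin /= -EFinD; congr (_ + _)%:E.
  rewrite -mulr_sumr -mulr_suml -mulr_suml omega1; field.
  by rewrite gt_eqF.
(* The difference of the first two squares is the affine remainder. *)
have JE : J y A mu (gme bPsi Bc \o Lc) = (fun x =>
    (2^-1 * `|y - A x| ^+ 2 - 2^-1 * `|0 - A x| ^+ 2 + 0)%:E
    + mu%:E * (\sum_i q i x + (eindicator C \o fC) x)).
  apply/funext => x; rewrite /J gme_constrained_comp gE qE.
  rewrite !muleDr ?fin_num_adde_defr// !addeA -!EFinM -!EFinD.
  congr (_%:E + _); rewrite sub0r normrN; field.
  by rewrite gt_eqF.
have [JNy lJ cJ] : lsc_convex (J y A mu (gme bPsi Bc \o Lc)).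
  rewrite JE; apply: lsc_convexD; first exact: lsc_convex_sqr_distB.
  apply: lsc_convex_scale => //; apply: lsc_convexD.
    apply: lsc_convex_sum => i; rewrite /q PsiE.
    apply: lsc_convex_gme => // [|z].
      by rewrite -PsiE; have [[PsiNy _] lP cP] := Psi_Gamma0 i.
    by rewrite -PsiE; exact: penalty_has_emin.
  by apply: lsc_convex_comp; exact: lsc_convex_eindicator.
split=> //; split=> //; exists x0.
rewrite /edom/= /J gme_constrained_comp gE /= /eindicator mem_set ?x0c//.
by rewrite adde0 -EFinM -EFinD ltry.
Qed.

End ModelConvexity.

Lemma sqr_norm_euclid (R : realType) n (x : euclid R n) :
  `|x| ^+ 2 = (x^T *m x) 0 0.
Proof.
by rewrite -inner_normE mxE; apply: eq_bigr => i _; rewrite mxE.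
Qed.

Theorem proposition3 (R : realType) :
  (* (a) *)
  (forall (M : nat) (X fZ : hilbertType R) (Z Zt : 'I_M -> hilbertType R)
      (Psi : forall i, Z i -> \bar R) (mus : 'I_M -> R)
      (B : forall i, {linear Z i -> Zt i}) (L : forall i, {linear X -> Z i})
      (C : set fZ) (fC : {linear X -> fZ}),
    (forall i, Gamma0 (Psi i)) ->
    (forall i, coercive (Psi i)) ->
    (forall i, edom (Psi i) = setT) ->
    (forall i, 0 < mus i) ->
    C !=set0 -> closed C -> convex_set (C : set (convex_lmodType fZ)) ->
    C `&` range fC !=set0 ->
    let bPsi := add_constraint (weighted_sum mus Psi) C in
    let Bc := zero_ext (W := fZ) (weighted_op mus B) in
    let Lc := pair_op (hprod_stack L) fC in
    [/\ (* the minima defining the penalties are attained *)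
        forall i (z : Z i), has_emin (range (gme_objective (Psi i) (B i) z)),
        forall z, has_emin (range (gme_objective bPsi Bc z)) &
        gme bPsi Bc \o Lc =
        (fun x => \sum_i (mus i)%:E * (gme (Psi i) (B i) \o L i) x
                  + (eindicator C \o fC) x)%E])
  /\
  (* (b) *)
  (forall (M n m : nat) (l : 'I_M -> nat) (fZ : hilbertType R)
      (Psi : forall i, euclid R (l i) -> \bar R) (mus : 'I_M -> R)
      (C : set fZ) (fC : {linear euclid R n -> fZ})
      (A : 'M[R]_(m, n)) (L : forall i, 'M[R]_(l i, n)) (mu : R)
      (y : euclid R m)
      (rankL : forall i, \rank (L i) = l i)
      (Lt : 'I_M -> 'M[R]_n) (omega : 'I_M -> R)
      (U : forall i, 'M[R]_(l i)) (d : forall i, 'rV[R]_(l i))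
      (theta : 'I_M -> R),
    (forall i, Gamma0 (Psi i)) ->
    (forall i, coercive (Psi i)) ->
    (forall i, edom (Psi i) = setT) ->
    (forall i, 0 < mus i) ->
    C !=set0 -> closed C -> convex_set (C : set (convex_lmodType fZ)) ->
    C `&` range fC !=set0 ->
    0 < mu ->
    (forall i, Lt i \in unitmx) ->
    (forall i, zero_id_mx (rank_le (rankL i)) *m Lt i = L i) ->
    (forall i, 0 < omega i) -> \sum_i omega i = 1 ->
    (forall i, 0 <= theta i <= 1) ->
    let At i := Num.sqrt (omega i / mu) *: (A *m invmx (Lt i)) in
    let A1 i := lblock (rank_le (rankL i)) (At i) in
    let A2 i := rblock (rank_le (rankL i)) (At i) in
    (forall i, eigendecomposition
       ((A2 i)^T *m A2 i
        - (A2 i)^T *m A1 i *m mpinv ((A1 i)^T *m A1 i) *m (A1 i)^T *m A2 i)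
       (U i) (d i)) ->
    let Bth i : 'M[R]_(l i) :=
      Num.sqrt (theta i / mus i) *: (sqrt_diag (d i) *m (U i)^T) in
    let bPsi := add_constraint (weighted_sum mus Psi) C in
    let Bc := zero_ext (W := fZ) (weighted_op mus (fun i => mxop (Bth i))) in
    let Lc := pair_op (hprod_stack (fun i => mxop (L i))) fC in
    (forall i, psdmx
       ((Num.sqrt (omega i / mu) *: A)^T *m (Num.sqrt (omega i / mu) *: A)
        - mus i *: ((L i)^T *m (Bth i)^T *m Bth i *m L i)))
    /\ Gamma0 (J y (mxop A) mu (gme bPsi Bc \o Lc))).
Proof.
split.
  move=> M X fZ Z Zt Psi mus B L C fC PsiG Psic Psid mus0 C0 cC vC CfC /=.
  split; [by move=> i z; exact: penalty_has_emin| |].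
    exact: constrained_penalty_has_emin.
  exact: gme_constrained_comp.
move=> M n m l fZ Psi mus C fC A L mu y rankL Lt omega U d theta.
move=> PsiG Psic Psid mus0 C0 cC vC CfC mu0 Ltu LtL omega0 omega1 theta01.
move=> At A1 A2 SUd Bth bPsi Bc Lc.
have psd i := psdmx_scaled_penalty (Ltu i) (LtL i) (mus0 i) (theta01 i) (SUd i).
split=> //; apply: Gamma0_J_gme omega1 cC vC _ => // i x.
have := psdmx_gram_le (psd i) x.
rewrite !sqr_norm_euclid sqr_sqrtr; first exact.
by apply: divr_ge0; exact: ltW.
Qed.
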